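(* For $n\ge3$ let $(G,\boldsymbol{x})=(G(n),\boldsymbol{x}(n))$ be the following input: a vertex $u$ adjacent to $v_1,\dots,v_n$ with $x_{u,v_i}=1/n$; all pairs $v_i,v_j$ ($i\ne j$) adjacent with $x_{v_i,v_j}=\frac{1}{n(n-1)}$; and for each $i$ a set $W_i$ of $n-2$ further vertices, each adjacent only to $v_i$, with $x_{v_i,w}=1/n$ for $w\in W_i$ (the $W_i$ pairwise disjoint). Let $W=\bigcup_i W_i$. Present the edges in a phase-based order: first all edges between $\{v_1,\dots,v_n\}$ and $W$ (in an arbitrary order), then all edges among $\{v_1,\dots,v_n\}$ (arbitrary order), then all edges at $u$ (arbitrary order). Let $\beta\approx0.3895$ be the unique solution in $(0,1)$ of $1-2\beta-\beta e^{2-1/\beta}=0$. Then any OCRS processing the edges of $(G,\boldsymbol{x})$ in a phase-based order is at most $(\beta+o(1))$-selectable on $(G,\boldsymbol{x})$, i.e., $\min_e\Pr[e\in\mathcal{M}\mid X_e=1]\le\beta+o(1)$ as $n\to\infty$.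
   Context: Each edge $e$ is independently active ($X_e=1$) with probability $x_e$. An OCRS knows $(G,\boldsymbol{x})$ (and may know the order in advance), sees edges one at a time in the given order, learns $X_e$ on arrival, and irrevocably decides whether to add $e$ to its matching $\mathcal{M}$; it may add $e$ only if $e$ is active and both endpoints are currently unmatched. $o(1)$ denotes a quantity tending to $0$ as $n\to\infty$, independent of the OCRS. *)

(* Defs.v *)
From mathcomp Require Import all_boot all_order all_algebra.
From mathcomp Require Import all_classical all_reals all_analysis.

Set Implicit Arguments.
Unset Strict Implicit.
Unset Printing Implicit Defensive.

Import Order.TTheory GRing.Theory Num.Theory.
Import numFieldNormedType.Exports.

Local Open Scope ring_scope.

(* Edges of a simple graph on V are two-element sets of vertices. *)

Section Ocrs.
Variables (R : realType) (V : finType).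

Definition edge : finType := {set V}.

(* What has been observed so far: the edges that have arrived, in order of
   arrival, each with its state (true = active). *)
Definition history := seq (edge * bool).

(* A deterministic online rule; it is consulted on the history that ends with
   the arriving edge and its state.  Past decisions are not recorded in the
   history because the rule and the history determine them. *)
Definition rule := history -> bool.

Fixpoint run (dec : rule) (A : {set edge}) (h : history) (M : {set edge})
    (order : seq edge) : {set edge} :=
  if order is e :: order' then
    let h' := rcons h (e, e \in A) in
    let M' := if [&& e \in A, [disjoint e & finset.cover M] & dec h']
              then (e |: M)%SET else M in
    run dec A h' M' order'
  else M.

Definition matching (dec : rule) (order : seq edge) (A : {set edge}) :
  {set edge} := run dec A [::] finset.set0 order.

(* X t is the set of active edges and Z t is the internal randomness of the
   OCRS.  The last clause says at once that the edges of E are active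
   independently, with probabilities x, and that Z is independent of X. *)
Definition ocrs_input (E : {set edge}) (x : edge -> R)
    (d : measure_display) (T : measurableType d) (P : probability T R)
    (d' : measure_display) (S : measurableType d')
    (X : T -> {set edge}) (Z : T -> S) : Prop :=
  [/\ forall A : {set edge}, measurable [set t | X t = A]%classic,
      measurable_fun setT Z &
      forall (A : {set edge}) (B : set S), A \subset E -> measurable B ->
        P [set t | X t = A /\ B (Z t)]%classic =
        (P [set t | B (Z t)]%classic *
         ((\prod_(e in E) (if e \in A then x e else 1 - x e))%R)%:E)%E].

(* A randomized OCRS is a rule depending measurably on the random seed. *)
Definition measurable_rule (d' : measure_display) (S : measurableType d')
    (dec : S -> rule) : Prop :=
  forall h : history, measurable [set z | dec z h]%classic.

Section Selectability.
Variables (d : measure_display) (T : measurableType d) (P : probability T R).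
Variables (d' : measure_display) (S : measurableType d').
Variables (X : T -> {set edge}) (Z : T -> S).

Definition cond_prob (A B : set T) : R :=
  fine (P (A `&` B)%classic) / fine (P B).

Definition edge_selection_prob (dec : S -> rule) (order : seq edge)
    (e : edge) : R :=
  cond_prob [set t | e \in matching (dec (Z t)) order (X t)]%classic
            [set t | e \in X t]%classic.

(* The default value 1 is neutral: the values are probabilities. *)
Definition selectability (E : {set edge}) (dec : S -> rule)
    (order : seq edge) : R :=
  \big[Num.min/1]_(e in E) edge_selection_prob dec order e.

End Selectability.
End Ocrs.

Section Instance.
Variable n : nat.

Definition vertex : finType := (unit + 'I_n + 'I_n * 'I_(n - 2))%type.

Definition vtx_u : vertex := inl (inl tt).
Definition vtx_v (i : 'I_n) : vertex := inl (inr i).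
(* The k-th vertex of W_i. *)
Definition vtx_w (i : 'I_n) (k : 'I_(n - 2)) : vertex := inr (i, k).

Definition edges_vw : {set edge vertex} :=
  [set [set vtx_v i; vtx_w i k] | i : 'I_n, k : 'I_(n - 2)]%SET.

Definition edges_vv : {set edge vertex} :=
  [set [set vtx_v i; vtx_v j] | i in 'I_n, j in 'I_n & i != j]%SET.

Definition edges_uv : {set edge vertex} :=
  [set [set vtx_u; vtx_v i] | i : 'I_n]%SET.

Definition edges : {set edge vertex} :=
  (edges_vw :|: edges_vv :|: edges_uv)%SET.

Definition edge_weight (R : realType) (e : edge vertex) : R :=
  if e \in edges_vv then (n%:R * (n%:R - 1))^-1 else n%:R^-1.

Definition phase_based (order : seq (edge vertex)) : Prop :=
  exists s1 s2 s3 : seq (edge vertex),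
    [/\ order = s1 ++ s2 ++ s3, perm_eq s1 (enum edges_vw),
        perm_eq s2 (enum edges_vv) & perm_eq s3 (enum edges_uv)].

End Instance.

Definition beta_root (R : realType) (b : R) : Prop :=
  0 < b < 1 /\ 1 - 2 * b - b * expR (2 - b^-1) = 0.

(* Main.v *)
(* Write F_j for the event that v_j is unmatched after the first phase, l for the
   index of the last edge at u, and m for the event that u is matched before that
   edge arrives.  If every edge is selected with conditional probability at least
   c then, up to O(1/n): P(~F_j) >= c for all j; P(F_j, F_l) >= c for all j <> l,
   because an edge v_j v_l arrives after the first phase and is independent of it;
   P(m) >= c; and P(~m, F_l) >= c.  Hence P(~m, ~F_l) <= 1 - 2c.  On the other hand
   u stays free when none of its active edges leads to a free v_j, and those edges
   are independent of the first phase, so with N = sum_{j <> l} F_j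
     P(~m, ~F_l) >= E[~F_l (1 - 1/n)^N] >= e^{-s} E[~F_l (1 + s - N/(n-1))],
   where E[~F_l N/(n-1)] <= 1 - 2c.  Taking for s the solution of s = e^{-s} gives
   c (2 + s) <= 1, and 1/(2 + s) is exactly beta. *)

Require Import Defs.
From mathcomp Require Import all_boot all_order all_algebra.
From mathcomp Require Import all_classical all_reals all_analysis.
From mathcomp Require Import ring lra.

Import Order.TTheory GRing.Theory Num.Theory.
Import numFieldNormedType.Exports.

Set Implicit Arguments.
Unset Strict Implicit.
Unset Printing Implicit Defensive.

Local Open Scope ring_scope.

(** * Online matchings *)

Section Matching.
Variables (V : finType) (dec : rule V).
Implicit Types (A M : {set edge V}) (h : history V) (s t : seq (edge V))
  (e f : edge V).

Lemma run_cat A h M s t :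
  run dec A h M (s ++ t) =
  run dec A (h ++ [seq (e, e \in A) | e <- s]) (run dec A h M s) t.
Proof.
elim: s h M => [|e s IHs] h M /=; first by rewrite cats0.
by rewrite IHs cat_rcons.
Qed.

Lemma run_eq_in A A' h M s :
  {in s, A =i A'} -> run dec A h M s = run dec A' h M s.
Proof.
elim: s h M => [//|e s IHs] h M eqA /=.
rewrite eqA ?mem_head //; apply: IHs => f fs.
by apply: eqA; rewrite inE fs orbT.
Qed.

Lemma sub_run A h M s : M \subset run dec A h M s.
Proof.
elim: s h M => [//|e s IHs] h M /=; apply: fintype.subset_trans (IHs _ _).
by case: ifP => // _; apply: finset.subsetUr.
Qed.

Lemma mem_run A h M s f :
  f \in run dec A h M s -> (f \in M) || (f \in s) && (f \in A).
Proof.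
elim: s h M => [|e s IHs] h M /=; first by rewrite orbF.
move=> /IHs; rewrite inE; case: ifP => [/andP[eA _]|_]; rewrite ?inE.
  by have [->|] := eqVneq f e; rewrite ?eA ?orbT.
by case/orP=> [->//|/andP[-> ->]]; rewrite !orbT.
Qed.

Lemma run_disjoint A h M s :
  {in M &, forall e f, e != f -> [disjoint e & f]} ->
  {in run dec A h M s &, forall e f, e != f -> [disjoint e & f]}.
Proof.
elim: s h M => [//|e s IHs] h M dM /=; apply: IHs; case: ifP => // cond f g.
have dis k : k \in M -> [disjoint e & k].
  move=> kM; case/and3P: cond => _ de _; apply: disjointWr de.
  exact: finset.bigcup_sup.
rewrite !in_setU1 => /orP[/eqP->|fM] /orP[/eqP->|gM].
- by rewrite eqxx.
- by move=> _; apply: dis.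
- by rewrite disjoint_sym => _; apply: dis.
- exact: dM.
Qed.

Lemma matching_eq_in A A' s :
  {in s, A =i A'} -> matching dec s A = matching dec s A'.
Proof. exact: run_eq_in. Qed.

Lemma sub_matching_cat A s t :
  matching dec s A \subset matching dec (s ++ t) A.
Proof. by rewrite /matching run_cat sub_run. Qed.

Lemma mem_matching A s e :
  e \in matching dec s A -> (e \in s) && (e \in A).
Proof. by move/mem_run; rewrite finset.in_set0. Qed.

Lemma matching_disjoint A s :
  {in matching dec s A &, forall e f, e != f -> [disjoint e & f]}.
Proof. by apply: run_disjoint => e; rewrite finset.in_set0. Qed.

Lemma matching_inj A s e f y :
  e \in matching dec s A -> f \in matching dec s A -> y \in e -> y \in f ->
  e = f.
Proof.
move=> eM fM ye yf; apply/eqP; apply/negPn/negP => nef.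
have := matching_disjoint eM fM nef.
by move/pred0P/(_ y); rewrite /= ye yf.
Qed.

Lemma matching_catl A s t e :
  e \notin t -> e \in matching dec (s ++ t) A -> e \in matching dec s A.
Proof.
by move=> /negPf net; rewrite /matching run_cat => /mem_run; rewrite net orbF.
Qed.

(** An edge [f] covering [y] after [s] is never discarded, so it would end up in the same matching
    as [e] and share [y] with it. Then [e = f], although [f] arrived during [s] and [e] did not. *)
Lemma matching_disjoint_before A s t e y :
  e \notin s -> e \in matching dec (s ++ t) A -> y \in e ->
  y \notin finset.cover (matching dec s A).
Proof.
move=> nes eM ye; apply/negP => /finset.bigcupP[f fM yf].
have fM' : f \in matching dec (s ++ t) A.
  by move: f fM {yf}; apply/fintype.subsetP; apply: sub_matching_cat.
have ef := matching_inj eM fM' ye yf; move: nes.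
by rewrite ef; case/andP: (mem_matching fM) => ->.
Qed.

End Matching.

(** * Expectation over a random rule and a random active set *)

Section RandomSubset.
Variables (R : realFieldType) (K G : finType) (E : {set K}) (x : K -> R).
Variable nu : G -> R.
Implicit Types (A : {set K}) (e : K) (phi psi : G * {set K} -> R).

(** The product law of the active set. It vanishes off the subsets of [E], so that sums can range
    over all of [{set K}]. *)
Definition subset_weight A : R :=
  if A \subset E then \prod_(e in E) (if e \in A then x e else 1 - x e) else 0.

Lemma sum_subset_weight : \sum_A subset_weight A = 1.
Proof.
pose F e := if e \in E then x e else 0.
pose F' e := if e \in E then 1 - x e else 1.
transitivity (\prod_(e : K) (F e + F' e)); last first.
  by rewrite big1 // => e _; rewrite /F /F'; case: ifP => _; ring.
rewrite bigA_distr; apply: eq_bigr => A _; rewrite /subset_weight.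
case: ifP => [AE|/negbT/fintype.subsetPn[e eA neE]].
  rewrite big_mkcond; apply: eq_bigr => e _; rewrite /F /F'.
  case: ifP => // neE; case: ifP => // eA.
  by move/fintype.subsetP: AE => /(_ e eA); rewrite neE.
by rewrite (bigD1 e) //= /F eA (negPf neE) mul0r.
Qed.

(** Invariance under this involution is how a quantity is said not to depend on the state of [e]. *)
Definition toggle e A := if e \in A then (A :\ e)%SET else (e |: A)%SET.

Lemma in_toggle e A f : f \in toggle e A = if f == e then e \notin A else f \in A.
Proof.
by rewrite /toggle; case: (boolP (e \in A)) => eA; rewrite !inE;
  have [->|] := eqVneq f e.
Qed.

Lemma toggleK e : involutive (toggle e).
Proof.
move=> A; apply/setP => f; rewrite !in_toggle eqxx.
by have [->|//] := eqVneq f e; rewrite negbK.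
Qed.

Lemma toggle_sub e A : e \in E -> (toggle e A \subset E) = (A \subset E).
Proof.
move=> eE; apply/fintype.subsetP/fintype.subsetP => sAE f;
  have := sAE f; rewrite in_toggle; by have [->|] := eqVneq f e.
Qed.

Lemma subset_weight_toggle e A : e \in E ->
  subset_weight A * ((e \in A)%:R - x e) =
  - (subset_weight (toggle e A) * ((e \in toggle e A)%:R - x e)).
Proof.
move=> eE; rewrite /subset_weight toggle_sub //; case: ifP; last by rewrite !mul0r oppr0.
move=> _; rewrite !(bigD1 e eE) /= in_toggle eqxx.
rewrite [in RHS](eq_bigr (fun f => if f \in A then x f else 1 - x f)); last first.
  by move=> f /andP[_ nfe]; rewrite in_toggle (negPf nfe).
by case: (e \in A) => /=; ring.
Qed.

Definition mean phi : R := \sum_o nu o.1 * subset_weight o.2 * phi o.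

Lemma mean_cst c : \sum_g nu g = 1 -> mean (fun=> c) = c.
Proof.
move=> nu1; rewrite /mean -mulr_suml.
rewrite -(pair_bigA _ (fun g A => nu g * subset_weight A)) /=.
under eq_bigr do rewrite -mulr_sumr sum_subset_weight mulr1.
by rewrite nu1 mul1r.
Qed.

Lemma meanD phi psi : mean (fun o => phi o + psi o) = mean phi + mean psi.
Proof. by rewrite /mean -big_split; apply: eq_bigr => o _; rewrite mulrDr. Qed.

Lemma meanZ c phi : mean (fun o => c * phi o) = c * mean phi.
Proof. by rewrite /mean mulr_sumr; apply: eq_bigr => o _; rewrite mulrCA. Qed.

Lemma mean_sum (I : finType) (Q : pred I) (F : I -> G * {set K} -> R) :
  mean (fun o => \sum_(i | Q i) F i o) = \sum_(i | Q i) mean (F i).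
Proof.
rewrite /mean exchange_big /=; apply: eq_bigr => o _.
by rewrite mulr_sumr.
Qed.

Lemma eq_mean phi psi : phi =1 psi -> mean phi = mean psi.
Proof. by move=> eq; apply: eq_bigr => o _; rewrite eq. Qed.

(** Toggling [e] is a bijection that changes the sign of every term of the mean of [phi] times the
    centred indicator of [e]. That mean equals its own opposite, hence is 0. *)
Lemma mean_indep phi e : e \in E ->
  (forall g A, phi (g, toggle e A) = phi (g, A)) ->
  mean (fun o => phi o * (e \in o.2)%:R) = x e * mean phi.
Proof.
move=> eE phie; apply/eqP; rewrite -subr_eq0 -meanZ; apply/eqP.
pose F o := nu o.1 * (phi o * (subset_weight o.2 * ((e \in o.2)%:R - x e))).
transitivity (\sum_o F o).
  by rewrite /mean -sumrB; apply: eq_bigr => o _; rewrite /F; ring.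
have inv : involutive (fun o : G * {set K} => (o.1, toggle e o.2)).
  by case=> g A /=; rewrite toggleK.
have : \sum_o F o = - \sum_o F o.
  rewrite {1}(reindex_inj (inv_inj inv)) /= -sumrN; apply: eq_bigr => -[g A] _.
  by rewrite /F /= phie (subset_weight_toggle A eE); ring.
by move=> H; lra.
Qed.

Hypothesis nu_ge0 : forall g, 0 <= nu g.
Hypothesis x01 : forall e, e \in E -> 0 <= x e <= 1.

Lemma subset_weight_ge0 A : 0 <= subset_weight A.
Proof.
rewrite /subset_weight; case: ifP => // _; apply: prodr_ge0 => e /x01 /andP[x0 x1].
by case: ifP => // _; rewrite subr_ge0.
Qed.

Lemma ler_mean phi psi : (forall o, phi o <= psi o) -> mean phi <= mean psi.
Proof.
move=> le; apply: ler_sum => o _; apply: ler_wpM2l => //.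
by rewrite mulr_ge0 ?subset_weight_ge0.
Qed.

End RandomSubset.

(** Indicators are averaged out one at a time by [mean_indep]. Neither [phi] nor any [F i] depends
    on the edges [e j], and injectivity of [e] makes the remaining indicators independent of the one
    being averaged. *)
Lemma mean_prod_indep (R : realFieldType) (K G : finType) (E : {set K})
    (x : K -> R) (nu : G -> R) (I : eqType) (e : I -> K) (J : seq I)
    (F : I -> G * {set K} -> R) (phi : G * {set K} -> R) :
  {in J &, injective e} -> uniq J -> {in J, forall j, e j \in E} ->
  {in J &, forall i j g A, F i (g, toggle (e j) A) = F i (g, A)} ->
  {in J, forall j g A, phi (g, toggle (e j) A) = phi (g, A)} ->
  mean E x nu (fun o => phi o * \prod_(j <- J) (1 - F j o * (e j \in o.2)%:R)) =
  mean E x nu (fun o => phi o * \prod_(j <- J) (1 - F j o * x (e j))).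
Proof.
elim: J phi => [|j J IHJ] phi einj /=.
  by move=> _ _ _ _; apply: eq_mean => o; rewrite !big_nil.
move=> /andP[njJ uJ] eE Fe phie.
have jJ : j \in j :: J by rewrite mem_head.
have sJ k : k \in J -> k \in j :: J by rewrite inE => ->; rewrite orbT.
(* The head factor joins the multiplier, so the induction hypothesis treats the tail first. *)
pose phi' o := phi o * (1 - F j o * (e j \in o.2)%:R).
pose psi o := phi o * \prod_(k <- J) (1 - F k o * x (e k)).
transitivity (mean E x nu (fun o => phi' o * \prod_(k <- J) (1 - F k o * x (e k)))).
  rewrite -IHJ //; first by apply: eq_mean => o; rewrite big_cons mulrA.
  - by move=> k l /sJ kJ /sJ lJ; apply: einj.
  - by move=> k /sJ; apply: eE.
  - by move=> k l /sJ kJ /sJ lJ; apply: Fe.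
  - move=> k kJ g A; rewrite /phi' (phie _ (sJ _ kJ)) (Fe _ _ jJ (sJ _ kJ)).
    have -> // : (e j \in toggle (e k) A) = (e j \in A).
    rewrite in_toggle; case: eqP => // /(einj _ _ jJ (sJ _ kJ)) ejk.
    by rewrite ejk kJ in njJ.
transitivity (mean E x nu psi + (-1) *
    mean E x nu (fun o => psi o * F j o * (e j \in o.2)%:R)).
  rewrite -meanZ -meanD; apply: eq_mean => o.
  by rewrite /phi' /psi; ring.
rewrite mean_indep; last 2 first.
- exact: eE.
- move=> g A; rewrite /psi phie // Fe //; congr (_ * _ * _).
  rewrite big_seq [in RHS]big_seq; apply: eq_bigr => k kJ.
  by rewrite (Fe _ _ (sJ _ kJ) jJ).
rewrite -!meanZ -meanD; apply: eq_mean => o; rewrite big_cons /psi; ring.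
Qed.

(** Serves to bound the number of selected edges at one vertex, which is at most 1, by the indicator
    that the vertex is matched. *)
Lemma sum_bool_le (R : numDomainType) (I : finType) (Q p : pred I) (b : bool) :
  (forall i, Q i -> p i -> b) ->
  (forall i j, Q i -> Q j -> p i -> p j -> i = j) ->
  \sum_(i | Q i) (p i)%:R <= b%:R :> R.
Proof.
move=> pb pinj; have [i /andP[Qi pi]|p0] := pickP (fun i => Q i && p i).
  rewrite (pb i) // (bigD1 i) //= pi big1 ?addr0 // => j /andP[Qj nji].
  by case pj: (p j) => //; move: nji; rewrite (pinj j i) ?eqxx.
rewrite big1 ?ler0n // => i Qi; move: (p0 i); rewrite Qi /= => ->//.
Qed.

(** * The instance *)

Section Edges.
Variable n : nat.
Implicit Types (i j l : 'I_n) (k : 'I_(n - 2)) (e : edge (vertex n)).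

Definition edge_vw j k : edge (vertex n) := [set vtx_v j; vtx_w j k]%SET.
Definition edge_vv i j : edge (vertex n) := [set vtx_v i; vtx_v j]%SET.
Definition edge_uv j : edge (vertex n) := [set vtx_u n; vtx_v j]%SET.

Lemma edge_vw_in j k : edge_vw j k \in edges_vw n.
Proof. by apply/imset2P; exists j k. Qed.

Lemma edge_vv_in i j : i != j -> edge_vv i j \in edges_vv n.
Proof. by move=> nij; apply/imset2P; exists i j => //; rewrite inE. Qed.

Lemma edge_uv_in j : edge_uv j \in edges_uv n.
Proof. by apply/imsetP; exists j. Qed.

Lemma edges_vwP e : reflect (exists j k, e = edge_vw j k) (e \in edges_vw n).
Proof.
apply: (iffP imset2P) => [[j k _ _ ->]|[j [k ->]]]; first by exists j, k.
by exists j k.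
Qed.

Lemma edges_uvP e : reflect (exists j, e = edge_uv j) (e \in edges_uv n).
Proof.
apply: (iffP imsetP) => [[j _ ->]|[j ->]]; first by exists j.
by exists j.
Qed.

Lemma edges_vvP e :
  reflect (exists i j, i != j /\ e = edge_vv i j) (e \in edges_vv n).
Proof.
apply: (iffP imset2P) => [[i j _]|[i [j [nij ->]]]].
  by rewrite inE => /andP[_ nij] ->; exists i, j.
by exists i j => //; rewrite inE.
Qed.

Lemma edge_uv_inj : injective edge_uv.
Proof.
move=> i j /setP /(_ (vtx_v i)); rewrite !inE eqxx orbT.
by move=> /esym /orP[] /eqP[].
Qed.

Lemma edge_vw_inj j : injective (edge_vw j).
Proof.
move=> k l /setP /(_ (vtx_w j k)); rewrite !inE eqxx orbT.
by move=> /esym /orP[] /eqP[].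
Qed.

Lemma u_notin_vw e : e \in edges_vw n -> vtx_u n \notin e.
Proof. by case/edges_vwP=> j [k ->]; rewrite !inE. Qed.

Lemma u_notin_vv e : e \in edges_vv n -> vtx_u n \notin e.
Proof. by case/edges_vvP=> i [j [_ ->]]; rewrite !inE. Qed.

Lemma w_notin_vv e j k : e \in edges_vv n -> vtx_w j k \notin e.
Proof. by case/edges_vvP=> i [l [_ ->]]; rewrite !inE. Qed.

Lemma w_notin_uv e j k : e \in edges_uv n -> vtx_w j k \notin e.
Proof. by case/edges_uvP=> i ->; rewrite !inE. Qed.

Lemma edge_vw_notin_vv j k : edge_vw j k \notin edges_vv n.
Proof. by apply/negP => /w_notin_vv -/(_ j k); rewrite !inE eqxx orbT. Qed.

Lemma edge_vw_notin_uv j k : edge_vw j k \notin edges_uv n.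
Proof. by apply/negP => /w_notin_uv -/(_ j k); rewrite !inE eqxx orbT. Qed.

Lemma edge_uv_notin_vw j : edge_uv j \notin edges_vw n.
Proof. by apply/negP => /u_notin_vw; rewrite !inE eqxx. Qed.

Lemma edge_uv_notin_vv j : edge_uv j \notin edges_vv n.
Proof. by apply/negP => /u_notin_vv; rewrite !inE eqxx. Qed.

Lemma edge_vv_notin_vw i j : i != j -> edge_vv i j \notin edges_vw n.
Proof.
by move=> nij; apply/negP => /edges_vwP[l [k Eij]];
  have := edge_vw_notin_vv l k; rewrite -Eij edge_vv_in.
Qed.

Variable R : realType.

Lemma edge_weight_vw j k : edge_weight R (edge_vw j k) = n%:R^-1.
Proof. by rewrite /edge_weight (negPf (edge_vw_notin_vv j k)). Qed.

Lemma edge_weight_uv j : edge_weight R (edge_uv j) = n%:R^-1.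
Proof. by rewrite /edge_weight (negPf (edge_uv_notin_vv j)). Qed.

Lemma edge_weight_vv i j :
  i != j -> edge_weight R (edge_vv i j) = (n%:R * (n%:R - 1))^-1.
Proof. by move=> nij; rewrite /edge_weight edge_vv_in. Qed.

Lemma edge_weight_gt0 e : (1 < n)%N -> 0 < edge_weight R e.
Proof.
move=> n1; have n1R : 1 < n%:R :> R by rewrite ltr1n.
by rewrite /edge_weight; case: ifP => _; rewrite invr_gt0 ?mulr_gt0; lra.
Qed.

Lemma edge_weight_le1 e : (1 < n)%N -> edge_weight R e <= 1.
Proof.
move=> n1; have n2R : 2 <= n%:R :> R by rewrite ler_nat.
by rewrite /edge_weight; case: ifP => _; rewrite invf_le1; nra.
Qed.

End Edges.

(** * The linear bound *)

Section PhaseBasedBound.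
Variables (R : realType) (n : nat) (G : finType) (nu : G -> R).
Variable (r : G -> rule (vertex n)).
Hypothesis n_ge3 : (3 <= n)%N.
Hypothesis nu_ge0 : forall g, 0 <= nu g.
Hypothesis nu_sum1 : \sum_g nu g = 1.
Variables (s1 s2 s3 : seq (edge (vertex n))) (l : 'I_n).
Hypothesis s1E : perm_eq s1 (enum (edges_vw n)).
Hypothesis s2E : perm_eq s2 (enum (edges_vv n)).
Hypothesis s3E : perm_eq (rcons s3 (edge_uv l)) (enum (edges_uv n)).
Implicit Types (o : G * {set edge (vertex n)}) (i j : 'I_n) (e : edge (vertex n)).

Let order := s1 ++ s2 ++ rcons s3 (edge_uv l).
Let x := @edge_weight n R.
Let E := mean (edges n) x nu.
Let match1 o := matching (r o.1) s1 o.2.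
(** The state just before the last edge [edge_uv l] arrives. *)
Let match_pre o := matching (r o.1) (s1 ++ s2 ++ s3) o.2.
Let selected e o := e \in matching (r o.1) order o.2.
Let free j o := vtx_v j \notin finset.cover (match1 o).
Let u_free o := vtx_u n \notin finset.cover (match_pre o).

Let mem1 : s1 =i edges_vw n.
Proof. by move=> e; rewrite (perm_mem s1E) mem_enum. Qed.
Let mem2 : s2 =i edges_vv n.
Proof. by move=> e; rewrite (perm_mem s2E) mem_enum. Qed.
Let mem3 : rcons s3 (edge_uv l) =i edges_uv n.
Proof. by move=> e; rewrite (perm_mem s3E) mem_enum. Qed.
Let l_notin_s3 : edge_uv l \notin s3.
Proof. by have := perm_uniq s3E; rewrite enum_uniq rcons_uniq => /andP[]. Qed.

Let orderE : order = (s1 ++ s2 ++ s3) ++ [:: edge_uv l].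
Proof. by rewrite /order -cats1 !catA. Qed.

Lemma last_notin_pre : edge_uv l \notin s1 ++ s2 ++ s3.
Proof.
by rewrite !mem_cat mem1 mem2 (negPf l_notin_s3) (negPf (edge_uv_notin_vw l))
  (negPf (edge_uv_notin_vv l)).
Qed.

Lemma free_toggle j e g A : e \notin s1 -> free j (g, toggle e A) = free j (g, A).
Proof.
move=> ne; rewrite /free /match1 /=; congr (_ \notin finset.cover _).
apply: matching_eq_in => f fs; rewrite in_toggle.
by case: eqP => // fe; move: ne; rewrite -fe fs.
Qed.

Lemma u_free_toggle g A : u_free (g, toggle (edge_uv l) A) = u_free (g, A).
Proof.
rewrite /u_free /match_pre /=; congr (_ \notin finset.cover _).
apply: matching_eq_in => f fs; rewrite in_toggle.
by case: eqP => // fe; move: last_notin_pre; rewrite -fe fs.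
Qed.

Lemma selected_free j e o :
  vtx_v j \in e -> e \notin s1 -> selected e o -> free j o.
Proof. by move=> je es1 /matching_disjoint_before; apply. Qed.

Lemma selected_active e o : selected e o -> e \in o.2.
Proof. by case/mem_matching/andP. Qed.

Lemma selected_vw j (k : 'I_(n - 2)) o : selected (edge_vw j k) o -> ~~ free j o.
Proof.
move=> sel; rewrite negbK; apply/finset.bigcupP; exists (edge_vw j k); last first.
  by rewrite !inE eqxx.
apply: matching_catl sel; rewrite mem_cat mem2 mem3.
by rewrite (negPf (edge_vw_notin_vv j k)) (negPf (edge_vw_notin_uv j k)).
Qed.

Lemma selected_uv j o : j != l -> selected (edge_uv j) o -> ~~ u_free o.
Proof.
move=> jl sel; rewrite negbK; apply/finset.bigcupP; exists (edge_uv j).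
  move: sel; rewrite /selected orderE; apply: matching_catl.
  by rewrite inE (inj_eq (@edge_uv_inj n)).
by rewrite !inE eqxx.
Qed.

Lemma selected_last o : selected (edge_uv l) o -> u_free o.
Proof.
rewrite /selected orderE => /matching_disjoint_before; apply.
  exact: last_notin_pre.
by rewrite !inE eqxx.
Qed.

(** The edge covering [u] arrived in the third phase, since no earlier edge contains [u], and before
    the last one. Its other endpoint must have survived the first phase unmatched. *)
Lemma not_u_free o : ~~ u_free o ->
  exists j, [/\ j != l, free j o & edge_uv j \in o.2].
Proof.
rewrite negbK => /finset.bigcupP[e eM ue].
case/andP: (mem_matching eM); rewrite !mem_cat mem1 mem2 => es eA.
have es3 : e \in s3.
  case/or3P: es => // [/u_notin_vw|/u_notin_vv]; by rewrite ue.
have : e \in edges_uv n by rewrite -mem3 mem_rcons inE es3 orbT.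
case/edges_uvP=> j ej; exists j; split; last by rewrite -ej.
  by apply: contraNneq l_notin_s3 => <-; rewrite -ej.
have es1 : e \notin s1 by rewrite ej mem1 edge_uv_notin_vw.
by apply: (matching_disjoint_before es1 eM); rewrite ej !inE eqxx orbT.
Qed.

Let sel e : R := E (fun o => (selected e o)%:R).
Let fr j o : R := (free j o)%:R.
Let uf o : R := (u_free o)%:R.

Let xle e : e \in edges n -> 0 <= x e <= 1.
Proof. by move=> _; rewrite ltW ?edge_weight_gt0 ?edge_weight_le1 // ltnW. Qed.

Let E_le phi psi : (forall o, phi o <= psi o) -> E phi <= E psi.
Proof. exact: ler_mean. Qed.

Let nR : 3 <= n%:R :> R. Proof. by rewrite ler_nat. Qed.

Lemma sel_vw_le j : \sum_k sel (edge_vw j k) + E (fr j) <= 1.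
Proof.
rewrite -(mean_sum _ _ _ predT (fun k o => (selected (edge_vw j k) o)%:R)) -meanD.
rewrite -[leRHS](@mean_cst _ _ _ (edges n) x nu 1) //; apply: E_le => o.
have : \sum_k (selected (edge_vw j k) o)%:R <= (~~ free j o)%:R :> R.
  apply: sum_bool_le => [k _|k k' _ _ sk sk']; first exact: selected_vw.
  apply: (@edge_vw_inj _ j); apply: (matching_inj sk sk' (y := vtx_v j));
    by rewrite !inE eqxx.
by rewrite /fr; case: (free j o) => /=; lra.
Qed.

(** Selection requires the edge to be active and both ends to be free after the first phase. The
    first phase ignores the state of this edge, so the probability factors. *)
Lemma sel_vv_le j : j != l ->
  sel (edge_vv j l) <= (n%:R * (n%:R - 1))^-1 * E (fun o => fr j o * fr l o).
Proof.
move=> jl; rewrite -(edge_weight_vv R jl).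
have ns1 : edge_vv j l \notin s1 by rewrite mem1 edge_vv_notin_vw.
rewrite -mean_indep; last 2 first.
- by rewrite !inE edge_vv_in ?orbT.
- by move=> g A; rewrite /fr !free_toggle.
apply: E_le => o; case S: (selected _ o); last by rewrite !mulr_ge0 ?ler0n.
rewrite /fr (selected_active S) (selected_free _ ns1 S) ?inE ?eqxx //.
by rewrite (selected_free _ ns1 S) ?inE ?eqxx ?orbT // !mulr1.
Qed.

Lemma sel_uv_le : \sum_(j | j != l) sel (edge_uv j) + E uf <= 1.
Proof.
rewrite -(mean_sum _ _ _ _ (fun j o => (selected (edge_uv j) o)%:R)) -meanD.
rewrite -[leRHS](@mean_cst _ _ _ (edges n) x nu 1) //; apply: E_le => o.
have : \sum_(j | j != l) (selected (edge_uv j) o)%:R <= (~~ u_free o)%:R :> R.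
  apply: sum_bool_le => [k|j k _ _ sj sk]; first exact: selected_uv.
  apply: (@edge_uv_inj n); apply: (matching_inj sj sk (y := vtx_u n));
    by rewrite !inE eqxx.
by rewrite /uf; case: (u_free o) => /=; lra.
Qed.

Lemma sel_last_le : sel (edge_uv l) <= n%:R^-1 * E (fun o => fr l o * uf o).
Proof.
rewrite -(edge_weight_uv R l).
have ns1 : edge_uv l \notin s1 by rewrite mem1 edge_uv_notin_vw.
rewrite -mean_indep; last 2 first.
- by rewrite !inE edge_uv_in ?orbT.
- by move=> g A; rewrite /fr /uf !free_toggle // u_free_toggle.
apply: E_le => o; case S: (selected _ o); last by rewrite !mulr_ge0 ?ler0n.
rewrite /fr /uf (selected_active S) (selected_last S).
by rewrite (selected_free _ ns1 S) ?inE ?eqxx ?orbT // !mulr1.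
Qed.

(* [u] certainly stays free when its active edges other than the last one all lead
   to vertices matched in the first phase; those edges are independent of it. *)
Lemma u_free_ge :
  E (fun o => (1 - fr l o) * \prod_(j | j != l) (1 - fr j o * n%:R^-1)) <=
  E (fun o => (1 - fr l o) * uf o).
Proof.
pose J := [seq j <- index_enum 'I_n | j != l].
have -> : E (fun o => (1 - fr l o) * \prod_(j | j != l) (1 - fr j o * n%:R^-1)) =
  E (fun o => (1 - fr l o) *
     \prod_(j <- J) (1 - fr j o * (edge_uv j \in o.2)%:R)).
  rewrite /E mean_prod_indep.
  - apply: eq_mean => o; rewrite big_filter; congr (_ * _).
    by apply: eq_bigr => j _; rewrite /x edge_weight_uv.
  - by move=> ? ? _ _; apply: edge_uv_inj.
  - by rewrite filter_uniq ?index_enum_uniq.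
  - by move=> j _; rewrite !inE edge_uv_in ?orbT.
  - by move=> i j _ _ g A; rewrite /fr free_toggle // mem1 edge_uv_notin_vw.
  - by move=> j _ g A; rewrite /fr free_toggle // mem1 edge_uv_notin_vw.
apply: E_le => o; rewrite big_filter /uf.
(* The comparison is pointwise: the product is at most 1 if [u] is free, and otherwise [not_u_free]
   supplies a vanishing factor. *)
have [_|nuf] := boolP (u_free o).
  rewrite mulr1 ler_piMr //; first by rewrite /fr; case: free => /=; lra.
  apply: prodr_ile1 => j _.
  by rewrite /fr; case: free; case: (_ \in _) => /=; lra.
have [j [jl fj ej]] := not_u_free nuf.
by rewrite (bigD1 j) //= /fr fj ej mulr1 subrr mul0r !mulr0.
Qed.

(* Tangent line of [expR] at [- s], applied after [1 - 1/n >= expR (- 1/(n-1))]. *)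
Lemma prod_free_ge (s : R) o :
  expR (- s) * (1 + s - (n%:R - 1)^-1 * \sum_(j | j != l) fr j o) <=
  \prod_(j | j != l) (1 - fr j o * n%:R^-1).
Proof.
set N := \sum_(j | _) _.
apply: (@le_trans _ _ (expR (- ((n%:R - 1)^-1 * N)))).
  rewrite [leRHS](_ : _ = expR (- s) * expR (s - (n%:R - 1)^-1 * N)); last first.
    by rewrite -expRD; congr expR; ring.
  rewrite ler_pM2l ?expR_gt0 //.
  by have := expR_ge1Dx (s - (n%:R - 1)^-1 * N); rewrite addrA.
rewrite mulr_sumr -sumrN expR_sum; apply: ler_prod => j _.
rewrite expR_ge0 /= /fr; case: free; last by rewrite mulr0 oppr0 expR0 mul0r subr0.
rewrite mulr1 mul1r expRN -[leRHS]invrK lef_pV2 ?posrE ?expR_gt0 ?invr_gt0 //.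
- apply: le_trans (expR_ge1Dx _).
  suff -> : (1 - n%:R^-1)^-1 = 1 + (n%:R - 1)^-1 :> R by [].
  field; apply/andP; split; apply/eqP => H; have := nR; lra.
- by rewrite subr_gt0 invf_lt1; have := nR; lra.
Qed.

Lemma phase_based_bound (s c : R) : 0 <= s -> expR (- s) = s -> 0 <= c ->
  {in edges n, forall e, c * x e <= sel e} ->
  c * (1 - 2 * n%:R^-1) * (2 + s) <= 1.
Proof.
move=> s_ge0 es c_ge0 c_le.
have n1_gt0 : 0 < n%:R - 1 :> R by have := nR; lra.
have n_gt0 : 0 < n%:R :> R by have := nR; lra.
have cvw j : E (fr j) <= 1 - c * (1 - 2 * n%:R^-1).
  have le := sel_vw_le j.
  suff : c * (1 - 2 * n%:R^-1) <= \sum_k sel (edge_vw j k) by lra.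
  have -> : c * (1 - 2 * n%:R^-1) = \sum_(k < n - 2) c * n%:R^-1.
    rewrite sumr_const card_ord -(mulr_natr _ (n - 2)) natrB; last exact: ltnW.
    by field; rewrite gt_eqF.
  apply: ler_sum => k _; rewrite -(edge_weight_vw R j k); apply: c_le.
  by rewrite !inE edge_vw_in.
have cvv j : j != l -> c <= E (fun o => fr j o * fr l o).
  move=> jl; rewrite -(@ler_pM2r _ (n%:R * (n%:R - 1))^-1) ?invr_gt0 ?mulr_gt0 //.
  rewrite [leRHS]mulrC; apply: le_trans (sel_vv_le jl).
  by rewrite -(edge_weight_vv R jl); apply: c_le; rewrite !inE edge_vv_in ?orbT.
have cl : c <= E (fun o => fr l o * uf o).
  rewrite -(@ler_pM2r _ n%:R^-1) ?invr_gt0 // [leRHS]mulrC.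
  apply: le_trans sel_last_le.
  by rewrite -(edge_weight_uv R l); apply: c_le; rewrite !inE edge_uv_in ?orbT.
have cu : E uf <= 1 - c * (1 - n%:R^-1).
  have le := sel_uv_le.
  suff : c * (1 - n%:R^-1) <= \sum_(j | j != l) sel (edge_uv j) by lra.
  have -> : c * (1 - n%:R^-1) = \sum_(j < n | j != l) c * n%:R^-1.
    rewrite sumr_const cardC1 card_ord -(mulr_natr _ n.-1) -subn1 natrB; last by rewrite ltnW // ltnW.
    by field; rewrite gt_eqF.
  apply: ler_sum => j _; rewrite -(edge_weight_uv R j); apply: c_le.
  by rewrite !inE edge_uv_in ?orbT.
have split_u : E uf = E (fun o => fr l o * uf o) + E (fun o => (1 - fr l o) * uf o).
  by rewrite -meanD; apply: eq_mean => o; ring.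
pose A : R := 1 - c * (1 - 2 * n%:R^-1) - c.
have N_le : E (fun o => (1 - fr l o) * ((n%:R - 1)^-1 * \sum_(j | j != l) fr j o)) <= A.
  have -> : A = (n%:R - 1)^-1 * \sum_(j < n | j != l) A.
    rewrite sumr_const cardC1 card_ord -(mulr_natr _ n.-1) -subn1 natrB; last by rewrite ltnW // ltnW.
    by field; rewrite gt_eqF.
  have -> : E (fun o => (1 - fr l o) * ((n%:R - 1)^-1 * \sum_(j | j != l) fr j o)) =
      (n%:R - 1)^-1 * \sum_(j | j != l) (E (fr j) + (-1) * E (fun o => fr j o * fr l o)).
    under eq_bigr do rewrite -meanZ -meanD.
    rewrite -mean_sum -meanZ; apply: eq_mean => o.
    rewrite mulrCA mulr_sumr; congr (_ * _); apply: eq_bigr => j _; ring.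
  rewrite ler_pM2l ?invr_gt0 //; apply: ler_sum => j jl.
  by have := cvw j; have := cvv j jl; rewrite /A; lra.
have key : s * ((1 + s) * (1 - E (fr l)) - A) <= E (fun o => (1 - fr l o) * uf o).
  apply: le_trans u_free_ge.
  apply: (@le_trans _ _ (E (fun o => (1 - fr l o) *
    (s * (1 + s - (n%:R - 1)^-1 * \sum_(j | j != l) fr j o))))); last first.
    apply: E_le => o; apply: ler_wpM2l; first by rewrite /fr; case: free => /=; lra.
    by rewrite -[X in X * _]es; apply: prod_free_ge.
  have -> : E (fun o => (1 - fr l o) *
      (s * (1 + s - (n%:R - 1)^-1 * \sum_(j | j != l) fr j o))) =
    s * ((1 + s) * (1 + (-1) * E (fr l)) + (-1) *
     E (fun o => (1 - fr l o) * ((n%:R - 1)^-1 * \sum_(j | j != l) fr j o))).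
    rewrite -[X in X + (-1) * E (fr l)](@mean_cst _ _ _ (edges n) x nu 1) //.
    rewrite -!meanZ -meanD -!meanZ -meanD -meanZ; apply: eq_mean => o; ring.
  by apply: ler_wpM2l => //; lra.
have y_gt0 : 0 < n%:R^-1 :> R by rewrite invr_gt0.
have cl2 := cvw l.
have h1 : s * (1 + s) * (c * (1 - 2 * n%:R^-1)) <= s * (1 + s) * (1 - E (fr l)).
  by apply: ler_wpM2l; [apply: mulr_ge0; lra | lra].
have h2 : 0 <= c * n%:R^-1 by apply: mulr_ge0 => //; apply: ltW.
have h3 : 0 <= s * (c * n%:R^-1) by apply: mulr_ge0.
move: key; rewrite /A => key.
rewrite -(@ler_pM2l _ (1 + s)); last lra.
lra.
Qed.

End PhaseBasedBound.

(** * The constant beta *)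

Lemma expRN_fixpoint (R : realType) : exists2 s : R, 0 < s & expR (- s) = s.
Proof.
have [||s _ /eqP] := @IVT R (fun t => t - expR (- t)) 0 1 0 ler01.
- apply: continuous_subspaceT => t; apply: cvgB; first exact: cvg_id.
  by apply: (@continuous_comp _ _ _ -%R expR); [exact: opp_continuous|exact: continuous_expR].
- rewrite oppr0 expR0 sub0r ge_min le_max subr_ge0.
  have -> : expR (- 1) <= 1 :> R by rewrite -[leRHS]expR0 ler_expR lerN10.
  by rewrite lerN10 orbT.
rewrite subr_eq0 => /eqP Es; exists s => //; rewrite Es; exact: expR_gt0.
Qed.

Lemma expRN_fixpoint_uniq (R : realType) (s t : R) :
  expR (- s) = s -> expR (- t) = t -> s = t.
Proof.
move=> es et; apply/eqP; rewrite eq_le; apply/andP; split; rewrite leNgt; apply/negP.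
  by move=> ts; have := ts; rewrite -ltrN2 -ltr_expR es et; lra.
by move=> ts; have := ts; rewrite -ltrN2 -ltr_expR es et; lra.
Qed.

Lemma beta_root_fixpoint (R : realType) (s : R) : 0 < s -> expR (- s) = s ->
  unique (@beta_root R) (2 + s)^-1.
Proof.
move=> s0 es; split; last first.
  move=> b [/andP[b0 _]] eb.
  have b_neq0 : b != 0 by rewrite gt_eqF.
  suff -> : s = b^-1 - 2 by rewrite addrC subrK invrK.
  apply: expRN_fixpoint_uniq es _; rewrite opprB.
  apply: (mulfI b_neq0); rewrite mulrBr mulfV //; lra.
rewrite /beta_root invr_gt0 invf_lt1; last lra.
split; first by apply/andP; split; lra.
rewrite invrK opprD addrA subrr add0r es; field; lra.
Qed.

(** * Reduction to finitely many deterministic rules *)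

Section FiniteValued.
Variables (R : realType) (d : measure_display) (T : measurableType d).
Variables (P : probability T R) (I : finType) (Y : T -> I).
Hypothesis mY : forall i, measurable [set t | Y t = i]%classic.

Lemma finite_valued_measurable (Q : pred I) :
  measurable [set t | Q (Y t)]%classic.
Proof.
have -> : [set t | Q (Y t)]%classic =
    (\bigcup_(i in [set i | Q i]) [set t | Y t = i])%classic.
  apply/seteqP; split => t /=; first by move=> Qt; exists (Y t).
  by case=> i /= Qi /= ->.
by apply: fin_bigcup_measurable => // *; exact: finite_finset.
Qed.

Lemma finite_valued_prob (Q : pred I) :
  fine (P [set t | Q (Y t)]%classic) =
  \sum_(i | Q i) fine (P [set t | Y t = i]%classic).
Proof.
pose D (s : seq I) := [set t | (Y t \in s) && Q (Y t)]%classic.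
suff H s : uniq s -> fine (P (D s)) =
    \sum_(i <- s | Q i) fine (P [set t | Y t = i]%classic).
  rewrite -H ?index_enum_uniq //; congr (fine (P _)).
  by apply/seteqP; split => t; rewrite /D /= mem_index_enum.
elim: s => [_|i s IHs /= /andP[nis us]].
  have -> : D [::] = set0 by apply/seteqP; split => t.
  by rewrite measure0 big_nil.
have mD : measurable (D s) by apply: (finite_valued_measurable (fun i => (i \in s) && Q i)).
rewrite big_cons -IHs //; case: ifPn => Qi.
  have -> : D (i :: s) = ([set t | Y t = i] `|` D s)%classic.
    apply/seteqP; split => t; rewrite /D /= inE.
      by case/andP => /orP[/eqP|->] //; [left | right].
    by case=> [->|/andP[-> ->]]; rewrite ?eqxx ?Qi ?orbT.
  rewrite measureU //; last first.
    by apply/seteqP; split => t; rewrite /D /= => -[] // -> ; rewrite (negPf nis).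
  by rewrite fineD ?fin_num_measure.
congr (fine (P _)); apply/seteqP; split => t; rewrite /D /= inE.
  by case/andP => /orP[/eqP->|-> -> //]; rewrite (negPf Qi).
by case/andP=> -> ->; rewrite orbT.
Qed.
End FiniteValued.

Section Reduction.
Variables (R : realType) (V : finType).
Implicit Types (e : edge V) (A : {set edge V}).

Lemma measurable_run (d' : measure_display) (S : measurableType d')
    (dec : S -> rule V) A h M s (Q : pred {set edge V}) :
  measurable_rule dec ->
  measurable [set z | Q (run (dec z) A h M s)]%classic.
Proof.
move=> mdec; elim: s h M => [|e s IHs] h M /=.
  by case: (Q M); [rewrite set_true | rewrite set_false].
set h' := rcons _ _; case: (boolP (e \in A)) => eA /=; last exact: IHs.
case: (boolP [disjoint e & _]) => de /=; last exact: IHs.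
have -> : [set z | Q (run (dec z) A h' (if dec z h' then (e |: M)%SET else M) s)]%classic =
  (([set z | dec z h'] `&` [set z | Q (run (dec z) A h' (e |: M)%SET s)]) `|`
   (~` [set z | dec z h'] `&` [set z | Q (run (dec z) A h' M s)]))%classic.
  apply/seteqP; split => z /=.
    by case: (dec z h') => Qz; [left | right].
  by case=> -[]; case: (dec z h').
apply: measurableU; apply: measurableI; try exact: IHs.
  exact: mdec.
by apply: measurableC; exact: mdec.
Qed.

Variables (d : measure_display) (T : measurableType d) (P : probability T R).
Variables (d' : measure_display) (S : measurableType d').
Variables (X : T -> {set edge V}) (Z : T -> S) (E : {set edge V}).
Variables (x : edge V -> R) (dec : S -> rule V) (order : seq (edge V)).
Hypothesis inputXZ : ocrs_input E x P X Z.
Hypothesis mdec : measurable_rule dec.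

(* The seed matters only through the induced map from active sets to matchings,
   which ranges over a finite type. *)
Let G : finType := {ffun {set edge V} -> {set edge V}}.
Let strategy (z : S) : G := [ffun A => matching (dec z) order A].
Let nu g : R := fine (P [set t | strategy (Z t) = g]%classic).
Let Y t := (strategy (Z t), X t).

Lemma measurable_strategy g : measurable [set z | strategy z = g]%classic.
Proof.
have -> : [set z | strategy z = g]%classic =
   (\bigcap_(A in [set: {set edge V}]) [set z | run (dec z) A [::] finset.set0 order == g A])%classic.
  apply/seteqP; split => z /=; first by move=> <- A _ /=; rewrite ffunE.
  by move=> H; apply/ffunP => A; rewrite ffunE; apply/eqP/(H A).
apply: fin_bigcap_measurable; first exact: finite_finset.
by move=> A _; apply: (measurable_run A [::] finset.set0 order (fun M => M == g A)).
Qed.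

Let mZ B : measurable B -> measurable [set t | B (Z t)]%classic.
Proof.
by case: inputXZ => _ mZ _ mB; rewrite -[X in measurable X]setTI; apply: mZ.
Qed.

Let mY i : measurable [set t | Y t = i]%classic.
Proof.
have -> : [set t | Y t = i]%classic =
   ([set t | strategy (Z t) = i.1] `&` [set t | X t = i.2])%classic.
  by rewrite /Y; apply/seteqP; split => t; case: i => g A /= [-> ->].
apply: measurableI; last by case: inputXZ.
exact: (mZ (measurable_strategy i.1)).
Qed.

Let probX A : A \subset E ->
  fine (P [set t | X t = A]%classic) = subset_weight E x A.
Proof.
move=> AE; case: inputXZ => _ _ /(_ A setT AE measurableT).
have -> : [set t | X t = A /\ setT (Z t)]%classic = [set t | X t = A]%classic.
  by apply/seteqP; split => t //= [].
have -> : [set t | setT (Z t)]%classic = setT by apply/seteqP; split.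
by rewrite probability_setT mul1e /subset_weight AE => ->.
Qed.

Let mX A : measurable [set t | X t = A]%classic. Proof. by case: inputXZ. Qed.

Lemma probX_outside A : ~~ (A \subset E) -> fine (P [set t | X t = A]%classic) = 0.
Proof.
move=> nAE.
have ge0 B : 0 <= fine (P [set t | X t = B]%classic) by rewrite fine_ge0.
have := finite_valued_prob P mX predT.
have -> : [set t | predT (X t)]%classic = setT by apply/seteqP; split.
rewrite probability_setT /= (bigID (fun B : {set edge V} => B \subset E)) /=.
rewrite (eq_bigr (subset_weight E x)); last by move=> B; apply: probX.
have -> : \sum_(B : {set edge V} | B \subset E) subset_weight E x B = 1.
  rewrite -(sum_subset_weight E x) [RHS](bigID (fun B : {set edge V} => B \subset E)) /=.
  rewrite [X in _ = _ + X]big1 ?addr0 // => B /negPf nBE.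
  by rewrite /subset_weight nBE.
move=> H.
have /eqP : \sum_(B : {set edge V} | ~~ (B \subset E)) fine (P [set t | X t = B]%classic) = 0.
  by lra.
by rewrite psumr_eq0 // => /allP /(_ A); rewrite mem_index_enum nAE => /(_ isT)/eqP.
Qed.

Let probY g A :
  fine (P [set t | Y t = (g, A)]%classic) = nu g * subset_weight E x A.
Proof.
have YE : [set t | Y t = (g, A)]%classic =
    [set t | X t = A /\ [set z | strategy z = g]%classic (Z t)]%classic.
  by rewrite /Y; apply/seteqP; split => t /= [-> ->].
have [AE|nAE] := boolP (A \subset E).
  rewrite YE; case: inputXZ => _ _ /(_ _ _ AE (measurable_strategy g)) ->.
  rewrite fineM //; last exact/fin_num_measure/mZ/measurable_strategy.
  by rewrite /subset_weight AE.
rewrite /subset_weight (negPf nAE) mulr0; apply/eqP.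
rewrite eq_le fine_ge0 // andbT -(probX_outside nAE).
apply: fine_le; rewrite ?fin_num_measure //.
by apply: le_measure; rewrite ?inE // YE => t /= [].
Qed.

Lemma edge_prob e : e \in E -> fine (P [set t | e \in X t]%classic) = x e.
Proof.
move=> eE; rewrite (finite_valued_prob P mX (fun A => e \in A)).
have -> : x e = mean E x (fun=> 1 : R) (fun o : unit * _ => 1 * (e \in o.2)%:R).
  by rewrite mean_indep // mean_cst ?mulr1 // big_const card_unit /= addr0.
rewrite /mean -(pair_bigA _ (fun _ A => _ * subset_weight E x A * (1 * (e \in A)%:R))) /=.
rewrite big_const card_unit /= addr0 big_mkcond; apply: eq_bigr => A _.
case: ifP => _; last by rewrite !mulr0.
rewrite !mulr1 mul1r; have [AE|nAE] := boolP (A \subset E); first exact: probX.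
by rewrite probX_outside // /subset_weight (negPf nAE).
Qed.

Lemma selection_reduction : exists (H : finType) (mu : H -> R) (r : H -> rule V),
  [/\ forall g, 0 <= mu g, \sum_g mu g = 1 &
   {in E, forall e, x e != 0 ->
     edge_selection_prob P X Z dec order e * x e =
     mean E x mu (fun o => (e \in matching (r o.1) order o.2)%:R)}].
Proof.
have mstr g : measurable [set t | strategy (Z t) = g]%classic.
  exact: (mZ (measurable_strategy g)).
have /choice[r rP] : forall g : G, exists q : rule V,
    nu g != 0 -> forall A, matching q order A = g A.
  move=> g; have [[t tg]|nt] := pselect (exists t, strategy (Z t) = g).
    by exists (dec (Z t)) => _ A; rewrite -tg ffunE.
  exists (fun=> false) => /eqP[]; rewrite /nu.
  have -> : [set t | strategy (Z t) = g]%classic = set0.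
    by apply/seteqP; split => t // tg; case: nt; exists t.
  by rewrite measure0.
exists G, nu, r; split.
- by move=> g; rewrite fine_ge0.
- rewrite -(finite_valued_prob P mstr predT).
  have -> : [set t | predT (strategy (Z t))]%classic = setT by apply/seteqP; split.
  by rewrite probability_setT.
move=> e eE xe0; rewrite /edge_selection_prob /cond_prob edge_prob // divfK //.
have -> : ([set t | e \in matching (dec (Z t)) order (X t)] `&` [set t | e \in X t])%classic =
    [set t | (fun o : G * {set edge V} => e \in o.1 o.2) (Y t)]%classic.
  apply/seteqP; split => t /=; rewrite ffunE; first by case.
  by move=> H; split => //; case/andP: (mem_matching H).
rewrite (finite_valued_prob P mY (fun o : G * {set edge V} => e \in o.1 o.2)).
rewrite big_mkcond; apply: eq_bigr => -[g A] _ /=; rewrite probY.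
have [->|nu0] := eqVneq (nu g) 0; first by rewrite !mul0r; case: ifP.
by rewrite rP //; case: ifP => _; rewrite ?mulr1 ?mulr0.
Qed.
End Reduction.

Lemma selectability_bound (R : realType) (s : R) (n : nat)
    (order : seq (edge (vertex n)))
    (d : measure_display) (T : measurableType d) (P : probability T R)
    (d' : measure_display) (S : measurableType d')
    (X : T -> {set edge (vertex n)}) (Z : T -> S)
    (dec : S -> rule (vertex n)) :
  0 < s -> expR (- s) = s -> (3 <= n)%N -> phase_based order ->
  ocrs_input (edges n) (@edge_weight n R) P X Z -> measurable_rule dec ->
  selectability P X Z (edges n) dec order * (1 - 2 / n%:R) <= (2 + s)^-1.
Proof.
move=> s_gt0 es n_ge3 [s1 [s2 [s3 [-> s1E s2E s3E]]]] inputXZ mdec.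
have nR : 3 <= n%:R :> R by rewrite ler_nat.
case/lastP: s3 s3E => [|s3' e] s3E.
  have n_gt0 : (0 < n)%N by apply: leq_trans n_ge3.
  have := perm_mem s3E (edge_uv (Ordinal n_gt0)).
  by rewrite mem_enum edge_uv_in in_nil.
have [l le] : exists l, e = edge_uv l.
  by apply/edges_uvP; rewrite -mem_enum -(perm_mem s3E) mem_rcons mem_head.
rewrite le in s3E *.
set c := selectability _ _ _ _ _ _.
have [c_le0|c_gt0] := leP c 0.
  apply: (@le_trans _ _ 0); last by rewrite invr_ge0; lra.
  by rewrite mulr_le0_ge0 // subr_ge0 ler_pdivrMr; lra.
have [H [mu [r [mu_ge0 mu1 selE]]]] := selection_reduction
  (s1 ++ s2 ++ rcons s3' (edge_uv l)) inputXZ mdec.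
rewrite -[leRHS]mul1r ler_pdivlMr; last lra.
apply: (phase_based_bound (r := r) n_ge3 mu_ge0 mu1 s1E s2E s3E (ltW s_gt0) es (ltW c_gt0)).
move=> f fE; have x_gt0 := edge_weight_gt0 R f (ltnW n_ge3).
rewrite -selE ?gt_eqF // ler_pM2r //.
exact: bigmin_le_cond.
Qed.

Theorem theorem7 (R : realType) :
  exists2 beta : R, unique (@beta_root R) beta &
  exists2 err : nat -> R, (err @ \oo --> (0 : R))%classic &
  forall (n : nat) (order : seq (edge (vertex n)))
    (d : measure_display) (T : measurableType d) (P : probability T R)
    (d' : measure_display) (S : measurableType d')
    (X : T -> {set edge (vertex n)}) (Z : T -> S)
    (dec : S -> rule (vertex n)),
    (3 <= n)%N ->
    phase_based order ->
    ocrs_input (edges n) (@edge_weight n R) P X Z ->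
    measurable_rule dec ->
    selectability P X Z (edges n) dec order <= beta + err n.
Proof.
have [s s_gt0 es] := expRN_fixpoint R.
have beta_gt0 : 0 < (2 + s)^-1 by rewrite invr_gt0; lra.
exists (2 + s)^-1; first exact: beta_root_fixpoint.
exists (fun n => 8 * (2 + s)^-1 * harmonic n).
  rewrite -[X in (_ --> X)%classic](mulr0 (8 * (2 + s)^-1)).
  by apply: cvgM; [exact: cvg_cst | exact: cvg_harmonic].
move=> n order d T P d' S X Z dec n_ge3 phase inputXZ mdec.
have := selectability_bound s_gt0 es n_ge3 phase inputXZ mdec.
move: (selectability _ _ _ _ _ _) (2 + s)^-1 beta_gt0 => c b b_gt0 le_cb.
have nR : 3 <= n%:R :> R by rewrite ler_nat.
rewrite /harmonic /= -(natr1 n); move: n%:R nR le_cb => N N3 le_cb.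
have -> : b + 8 * b * (N + 1)^-1 = b * (N + 9) / (N + 1) by field; lra.
rewrite ler_pdivlMr; last lra.
have le_cb' : c * (N - 2) <= b * N.
  have -> : c * (N - 2) = c * (1 - 2 / N) * N by field; lra.
  by rewrite ler_pM2r //; lra.
rewrite -(@ler_pM2r _ (N - 2)); last lra.
nra.
Qed.
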